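(* For each integer $d\ge 2$, let $C_L^{as}(d)$ be the sharp (i.e. largest) constant such that $$C_{L}^{as}(d)\sum_{n \in \mathbb{Z}^d} \frac{|u(n)|^2}{|n|^2} \leq \sum_{n \in \mathbb{Z}^d} |Du(n)|^2$$ holds for all antisymmetric $u \in C_c(\mathbb{Z}^d)$. Then $C_L^{as}(d) \sim d^4$ as $d \to \infty$; that is, there exist positive constants $c_1, c_2$ and $N$, all independent of $d$, such that $c_1d^4 \leq C_L^{as}(d) \leq c_2 d^4$ for all $d \geq N$.
   Context: $C_c(\mathbb{Z}^d)$ denotes the space of finitely supported complex-valued functions on $\mathbb{Z}^d$. A function $u$ is antisymmetric if $u(\dots,n_j,\dots,n_i,\dots) = -u(\dots,n_i,\dots,n_j,\dots)$ for all $1\le i\neq j\le d$, i.e. interchanging any two coordinates of the argument changes the sign of $u$. $|n|$ is the Euclidean norm. For $1\le j\le d$, $D_j u(n) := u(n)-u(n-e_j)$, where $e_j$ is the $j$-th standard basis vector, $Du(n) := (D_1u(n),\dots,D_du(n))$, and $|Du(n)|^2=\sum_{j=1}^d |D_ju(n)|^2$. Since $d\ge 2$, antisymmetry forces $u(0)=0$, and the term $n=0$ in the left-hand sum is understood as $0$. *)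

(* Defs.v *)
From HB Require Import structures.
From mathcomp Require Import all_boot all_order all_algebra.
From mathcomp Require Import complex.
From mathcomp Require Import all_classical all_reals.

Set Implicit Arguments.
Unset Strict Implicit.
Unset Printing Implicit Defensive.

Import Order.TTheory GRing.Theory Num.Theory.

Local Open Scope classical_set_scope.
Local Open Scope ring_scope.

Definition lattice (d : nat) := 'rV[int]_d.

Section HardyLattice.
Variables (R : realType) (d : nat).
Implicit Types (u : lattice d -> R[i]) (n : lattice d).

Definition finitely_supported u := finite_set [set n | u n != 0].

(* [xcol i j n] is n with its i-th and j-th coordinates interchanged. *)
Definition antisymmetric_fun u :=
  forall i j : 'I_d, i != j -> forall n, u (xcol i j n) = - u n.

Definition lnorm n : R := Num.sqrt (\sum_(j < d) (n ord0 j)%:~R ^+ 2).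

Definition cabs : R[i] -> R := @ComplexField.Normc.normc R.

(* [delta_mx ord0 j] is the j-th standard basis vector. *)
Definition diff (j : 'I_d) u n : R[i] := u n - u (n - delta_mx ord0 j).

Definition grad_sq u n : R := \sum_(j < d) cabs (diff j u n) ^+ 2.

(* Both sums over the lattice are finite-support sums, equal to the usual sums
   when u is finitely supported.  At n = 0 the Hardy summand is a division by 0,
   hence equal to 0. *)
Definition hardy_sum u : R :=
  \sum_(n \in [set: lattice d]) (cabs (u n) ^+ 2 / lnorm n ^+ 2).

Definition energy u : R := \sum_(n \in [set: lattice d]) grad_sq u n.

End HardyLattice.

Definition hardy_constant (R : realType) (d : nat) (C : R) :=
  forall u : lattice d -> R[i], finitely_supported u -> antisymmetric_fun u ->
    C * hardy_sum u <= energy u.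

Definition is_largest (R : realType) (A : set R) (x : R) :=
  A x /\ forall y, A y -> y <= x.

Definition C_L_as (R : realType) (d : nat) : R :=
  sup [set C : R | hardy_constant d C].

(* Main.v *)
Require Import Defs.
From HB Require Import structures.
From mathcomp Require Import all_boot all_order all_algebra.
From mathcomp Require Import all_fingroup.
From mathcomp Require Import complex.
From mathcomp Require Import all_classical all_reals.
From mathcomp Require Import finmap ring lra zify.

Set Implicit Arguments.
Unset Strict Implicit.
Unset Printing Implicit Defensive.

Import Order.TTheory GRing.Theory Num.Theory.

Local Open Scope classical_set_scope.
Local Open Scope ring_scope.

(** Why the constant has order d^4.

    Lower bound. An antisymmetric u vanishes at every lattice point with two
    equal coordinates. So, as a function of the single coordinate n_j, it
    vanishes whenever n_j meets another coordinate: on the interval between the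
    predecessor p and the successor q of n_j among the coordinates of n it
    satisfies Dirichlet conditions at both ends. On that interval the parabola
    g(x) = (x - p)(q - x) is positive, and -(g(x-1) - 2 g(x) + g(x+1)) / g(x) is
    exactly 2 / g(x). The ground state inequality
      |z - w|^2 >= (1 - b/a) |z|^2 + (1 - a/b) |w|^2   (a, b > 0)
    applied to every edge of the lattice (lemma energy_ge) turns this into
      energy u >= sum_n |u(n)|^2 sum_j 2 / ((n_j - p_j) (q_j - n_j)).
    It is essential that this is done in all d directions at once without
    averaging: each direction contributes the square of an inverse gap.

    The d distinct coordinates of n have about half of their members in an
    interval of length of order |n| / sqrt d, so that the gaps there are on
    average of order |n| / d^(3/2). Convexity then bounds the inner sum from
    below by a multiple of d * d^3 / |n|^2 (lemmas gap_sum_ge and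
    profile_sum_ge).

    Upper bound. For every u the energy is at most 4 d sum_n |u(n)|^2, so it is
    enough to concentrate u near the origin. The function supported on the
    permutations of (0, 1, ..., d-1), with the sign of the permutation as value,
    is antisymmetric, and |n|^2 <= d^3 on its support; this gives
    C <= 4 d * d^3 (lemma hardy_constant_upper).

    The admissible constants contain 0, are bounded above, and are cut out by
    non-strict inequalities, so their supremum is attained. *)

(** * Sums over finitely supported functions *)

Section FiniteSupportSums.
Variables (R : realType) (T : choiceType).
Implicit Types F G : T -> R.

Definition fin_supp F := finite_set [set n | F n != 0].

Lemma fin_supp_sub F G :
  fin_supp F -> (forall n, F n = 0 -> G n = 0) -> fin_supp G.
Proof.
move=> fF FG; apply: sub_finite_set fF => n /=.
by apply: contra_neq => /FG.
Qed.

Lemma fin_suppD F G : fin_supp F -> fin_supp G -> fin_supp (fun n => F n + G n).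
Proof.
move=> fF fG; apply: (@sub_finite_set _ _ ([set n | F n != 0] `|` [set n | G n != 0])).
  move=> n /=; have [->|] := eqVneq (F n) 0; last by left.
  by rewrite add0r; right.
by rewrite finite_setU.
Qed.

Lemma fin_supp_shift (h : T -> T) F :
  bijective h -> fin_supp F -> fin_supp (fun n => F (h n)).
Proof.
move=> [k hk kh] fF.
apply: (@sub_finite_set _ _ (k @` [set n | F n != 0])); last exact: finite_image.
by move=> n /= Fn; exists (h n) => //; rewrite hk.
Qed.

Lemma fsum_fset F (A : set T) : finite_set A -> (forall n, F n != 0 -> A n) ->
  \sum_(n \in [set: T]) F n = \sum_(n <- fset_set A) F n.
Proof.
move=> fA FA; apply: fsbigTE => n; rewrite in_fset_set// => nA.
by apply/eqP; apply: contraNT nA => /FA /mem_set.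
Qed.

Lemma fsumD F G : fin_supp F -> fin_supp G ->
  \sum_(n \in [set: T]) (F n + G n) =
  \sum_(n \in [set: T]) F n + \sum_(n \in [set: T]) G n.
Proof.
move=> fF fG.
have fA : finite_set ([set n | F n != 0] `|` [set n | G n != 0]).
  by rewrite finite_setU.
rewrite (@fsum_fset F _ fA); last by left.
rewrite (@fsum_fset G _ fA); last by right.
rewrite (@fsum_fset _ _ fA) ?big_split// => n /=.
have [->|] := eqVneq (F n) 0; last by left.
by rewrite add0r; right.
Qed.

Lemma fsum_reindex (h : T -> T) F : bijective h ->
  \sum_(n \in [set: T]) F n = \sum_(n \in [set: T]) F (h n).
Proof. exact: reindex_fsbigT. Qed.

Lemma ler_fsum F G : fin_supp F -> fin_supp G -> (forall n, F n <= G n) ->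
  \sum_(n \in [set: T]) F n <= \sum_(n \in [set: T]) G n.
Proof.
move=> fF fG FG.
have fA : finite_set ([set n | F n != 0] `|` [set n | G n != 0]).
  by rewrite finite_setU.
rewrite (@fsum_fset F _ fA); last by left.
rewrite (@fsum_fset G _ fA); last by right.
exact: ler_sum.
Qed.

Lemma fin_supp_sum (I : Type) (r : seq I) (F : I -> T -> R) :
  (forall i, fin_supp (F i)) -> fin_supp (fun n => \sum_(i <- r) F i n).
Proof.
move=> fF; elim: r => [|i r IH].
  apply: (@sub_finite_set _ _ set0) => // n /=.
  by rewrite big_nil eqxx.
apply: fin_supp_sub (fin_suppD (fF i) IH) _ => n.
by rewrite big_cons.
Qed.

Lemma exchange_fsum (I : Type) (r : seq I) (F : I -> T -> R) :
  (forall i, fin_supp (F i)) ->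
  \sum_(n \in [set: T]) \sum_(i <- r) F i n =
  \sum_(i <- r) \sum_(n \in [set: T]) F i n.
Proof.
move=> fF; elim: r => [|i r IH].
  by rewrite big_nil fsbig1// => n _; rewrite big_nil.
rewrite big_cons -IH -fsumD//; last exact: fin_supp_sum.
by apply: eq_fsbigr => n _; rewrite big_cons.
Qed.

End FiniteSupportSums.

(** * The ground state inequality on one edge *)

Section GroundStateEdge.
Variable R : realType.

Lemma cabs_sq (z : R[i]) : cabs z ^+ 2 = complex.Re z ^+ 2 + complex.Im z ^+ 2.
Proof.
by case: z => a b; rewrite /cabs /= sqr_sqrtr// addr_ge0 ?sqr_ge0.
Qed.

Lemma cabs0 : cabs (0 : R[i]) = 0.
Proof. exact: ComplexField.Normc.normc0. Qed.

Lemma cabs_sq_eq0 (z : R[i]) : (cabs z ^+ 2 == 0) = (z == 0).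
Proof.
rewrite sqrf_eq0; apply/eqP/eqP => [/ComplexField.Normc.eq0_normc //|->].
exact: cabs0.
Qed.

(** The difference of the two sides is the square (b x - a y)^2 / (a b). *)
Lemma real_ground_state_edge (a b x y : R) : 0 < a -> 0 < b ->
  (1 - b / a) * x ^+ 2 + (1 - a / b) * y ^+ 2 <= (x - y) ^+ 2.
Proof.
move=> a0 b0; rewrite -subr_ge0.
have -> : (x - y) ^+ 2 - ((1 - b / a) * x ^+ 2 + (1 - a / b) * y ^+ 2)
   = (b * x - a * y) ^+ 2 / (a * b).
  by field; rewrite !gt_eqF.
by rewrite divr_ge0 ?sqr_ge0// ltW// mulr_gt0.
Qed.

(** Allowing a or b to vanish together with the function costs nothing, because
    the quotient by 0 is then 0 or is multiplied by 0: this is how the Dirichlet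
    condition at the walls of a chamber enters. *)
Lemma ground_state_edge (a b : R) (z w : R[i]) : 0 <= a -> 0 <= b ->
  (a = 0 -> z = 0) -> (b = 0 -> w = 0) ->
  (1 - b / a) * cabs z ^+ 2 + (1 - a / b) * cabs w ^+ 2 <= cabs (z - w) ^+ 2.
Proof.
rewrite le0r => /orP[/eqP a0|a0]; rewrite le0r => /orP[/eqP b0|b0] az bw.
- by rewrite az// bw// subrr cabs0 expr0n /= !mulr0 addr0.
- rewrite az// a0 mul0r subr0 mul1r sub0r !cabs_sq.
  by case: w {bw} => c e /=; rewrite expr0n /= addr0 mulr0 add0r !sqrrN.
- rewrite bw// b0 mul0r subr0 mul1r subr0 !cabs_sq.
  by case: z {az} => c e /=; rewrite expr0n /= addr0 mulr0 addr0.
case: z w {az bw} => x x' [y y']; rewrite !cabs_sq /=.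
have := real_ground_state_edge x y a0 b0.
have := real_ground_state_edge x' y' a0 b0; lra.
Qed.

(** The parallelogram identity with the term |z + w|^2 dropped. *)
Lemma cabsB_sq (z w : R[i]) :
  cabs (z - w) ^+ 2 <= 2 * cabs z ^+ 2 + 2 * cabs w ^+ 2.
Proof.
case: z w => x x' [y y']; rewrite !cabs_sq /= -subr_ge0.
have := sqr_ge0 (x + y); have := sqr_ge0 (x' + y'); lra.
Qed.
End GroundStateEdge.

(** * Bounds on the energy *)

Section Energy.
Variables (R : realType) (d : nat) (u : lattice d -> R[i]).
Hypothesis fu : finitely_supported u.

Lemma fin_supp_cabs : fin_supp (fun n => cabs (u n) ^+ 2).
Proof.
by apply: sub_finite_set fu => n /=; rewrite cabs_sq_eq0.
Qed.

Lemma shift_bij (e : lattice d) : bijective (fun n : lattice d => n + e).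
Proof. by exists (fun n => n - e) => n; rewrite ?addrK ?subrK. Qed.

Lemma shiftN_bij (e : lattice d) : bijective (fun n : lattice d => n - e).
Proof. by exists (fun n => n + e) => n; rewrite ?addrK ?subrK. Qed.

Lemma fin_supp_cabs_shift e : fin_supp (fun n => cabs (u (n - e)) ^+ 2).
Proof. exact: (fin_supp_shift (shiftN_bij e) fin_supp_cabs). Qed.

Lemma fin_supp_diff j : fin_supp (fun n => cabs (diff j u n) ^+ 2).
Proof.
apply: fin_supp_sub (fin_suppD fin_supp_cabs (fin_supp_cabs_shift (delta_mx ord0 j))) _.
move=> n; have := sqr_ge0 (cabs (u n)).
have := sqr_ge0 (cabs (u (n - delta_mx ord0 j))) => h1 h2 h3.
have := cabsB_sq (u n) (u (n - delta_mx ord0 j)).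
rewrite /diff; have := sqr_ge0 (cabs (u n - u (n - delta_mx ord0 j))); lra.
Qed.

Lemma energyE : energy u =
  \sum_(j < d) \sum_(n \in [set: lattice d]) cabs (diff j u n) ^+ 2.
Proof. by apply: exchange_fsum => j; exact: fin_supp_diff. Qed.

Lemma energy_le :
  energy u <= 4 * d%:R * \sum_(n \in [set: lattice d]) cabs (u n) ^+ 2.
Proof.
rewrite energyE; set S := \sum_(n \in _) _.
apply: (@le_trans _ _ (\sum_(j < d) (2 * S + 2 * S))); last first.
  by rewrite big_const_ord iter_addr_0 -mulr_natr; lra.
apply: ler_sum => j _; pose e : lattice d := delta_mx ord0 j.
have -> : 2 * S + 2 * S = \sum_(n \in [set: lattice d])
    (2 * cabs (u n) ^+ 2 + 2 * cabs (u (n - e)) ^+ 2).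
  rewrite fsumD; last 2 first.
  - by apply: fin_supp_sub fin_supp_cabs _ => n ->; rewrite mulr0.
  - by apply: fin_supp_sub (fin_supp_cabs_shift e) _ => n ->; rewrite mulr0.
  rewrite -!mulr_fsumr; congr (_ + 2 * _).
  exact/fsum_reindex/shiftN_bij.
apply: ler_fsum; [exact: fin_supp_diff| | by move=> n; exact: cabsB_sq].
apply: fin_suppD.
- by apply: fin_supp_sub fin_supp_cabs _ => n ->; rewrite mulr0.
- by apply: fin_supp_sub (fin_supp_cabs_shift e) _ => n ->; rewrite mulr0.
Qed.

(** Barta-type bound: the edge inequality is summed over all edges, and a shift by
    the j-th basis vector brings both terms of an edge to the same point, where
    they add up to minus the Laplacian of g_j in direction j, divided by g_j.
    Each direction has its own function g_j. *)
Lemma energy_ge (g : 'I_d -> lattice d -> R) (w : lattice d -> R) :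
  (forall j n, 0 <= g j n) -> (forall j n, g j n = 0 -> u n = 0) ->
  (forall n, u n != 0 -> w n <= \sum_(j < d)
     (2 - (g j (n - delta_mx ord0 j) + g j (n + delta_mx ord0 j)) / g j n)) ->
  \sum_(n \in [set: lattice d]) w n * cabs (u n) ^+ 2 <= energy u.
Proof.
move=> g0 gu gw; rewrite energyE.
pose e j : lattice d := delta_mx ord0 j.
pose a j n := 1 - g j (n - e j) / g j n.
pose b j n := 1 - g j n / g j (n - e j).
have supp j F : fin_supp (fun n => F n * cabs (u (n - e j)) ^+ 2).
  by apply: fin_supp_sub (fin_supp_cabs_shift (e j)) _ => n ->; rewrite mulr0.
have supp0 F : fin_supp (fun n => F n * cabs (u n) ^+ 2).
  by apply: fin_supp_sub fin_supp_cabs _ => n ->; rewrite mulr0.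
apply: (@le_trans _ _ (\sum_(j < d) \sum_(n \in [set: lattice d])
   (a j n * cabs (u n) ^+ 2 + b j n * cabs (u (n - e j)) ^+ 2))); last first.
  apply: ler_sum => j _; apply: ler_fsum.
  - exact: fin_suppD.
  - exact: fin_supp_diff.
  by move=> n; apply: ground_state_edge => //; exact: gu.
have -> : \sum_(j < d) \sum_(n \in [set: lattice d])
     (a j n * cabs (u n) ^+ 2 + b j n * cabs (u (n - e j)) ^+ 2) =
   \sum_(j < d) \sum_(n \in [set: lattice d])
     ((a j n + b j (n + e j)) * cabs (u n) ^+ 2).
  apply: eq_bigr => j _; rewrite fsumD//.
  rewrite (fsum_reindex (fun n => b j n * cabs (u (n - e j)) ^+ 2)
    (shift_bij (e j))).
  rewrite -fsumD//.
    by apply: eq_fsbigr => n _; rewrite addrK [RHS]mulrDl.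
  by apply: fin_supp_sub fin_supp_cabs _ => n; rewrite addrK => ->; rewrite mulr0.
rewrite -exchange_fsum//; apply: ler_fsum => //.
  exact: fin_supp_sum.
move=> n; have [un|un] := eqVneq (u n) 0.
  by rewrite un cabs0 expr0n /= mulr0 big1// => j _; rewrite mulr0.
rewrite -mulr_suml ler_wpM2r ?sqr_ge0//; apply: le_trans (gw n un) _.
by apply: ler_sum => j _; rewrite /a /b addrK [X in 2 - X]mulrDl; lra.
Qed.
End Energy.

(** * Inverse gaps of an increasing sequence *)

Section GapSum.
Variable R : realType.

(** The mean inequality for the three numbers 1 / (x y), l^3 x and l^3 y: a bound
    which is linear in the gaps, hence telescopes, and is sharp at x = y = 1 / l. *)
Lemma amgm_recip (l x y : R) : 0 <= l -> 0 < x -> 0 < y ->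
  6 * l ^+ 2 - 2 * l ^+ 3 * (x + y) <= 2 / (x * y).
Proof.
move=> l0 x0 y0; have xy0 : 0 < x * y by exact: mulr_gt0.
rewrite ler_pdivlMr// -subr_ge0.
pose s := l * (x + y); pose p := l ^+ 2 * (x * y).
have -> : 2 - (6 * l ^+ 2 - 2 * l ^+ 3 * (x + y)) * (x * y)
   = 2 * (1 + p * s - 3 * p) by rewrite /s /p; ring.
have s0 : 0 <= s by rewrite mulr_ge0// ltW// addr_gt0.
have p0 : 0 <= p by rewrite mulr_ge0 ?sqr_ge0// ltW.
have ps : 4 * p <= s ^+ 2.
  have := sqr_ge0 (l * (x - y)); rewrite /s /p; lra.
rewrite mulr_ge0//.
have [s3|s3] := lerP 3 s; first by have := mulr_ge0 p0 (_ : 0 <= s - 3); lra.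
have h : 4 * p * (3 - s) <= s ^+ 2 * (3 - s) by rewrite ler_wpM2r//; lra.
have : 0 <= (s - 2) ^+ 2 * (s + 1) by rewrite mulr_ge0 ?sqr_ge0//; lra.
lra.
Qed.

Variables (a : nat -> R) (d : nat).
Hypothesis a_lt : forall i k, (i < k < d)%N -> a i < a k.

Let a_le i k : (i <= k)%N -> (k < d)%N -> a i <= a k.
Proof.
rewrite leq_eqVlt => /orP[/eqP ->//|ik] kd.
by apply/ltW/a_lt; rewrite ik.
Qed.

Lemma gap_term_gt0 k : (0 < k)%N -> (k.+1 < d)%N ->
  0 < (a k - a k.-1) * (a k.+1 - a k).
Proof. by move=> k0 kd; rewrite mulr_gt0// subr_gt0 a_lt//; lia. Qed.

(** Each of the m pairs (a i, a (d - 1 - i)), i < m, is at least as far apart as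
    the pair in the lemma, and distant points cannot both be near 0. *)
Lemma spread_le m : (0 < m)%N -> (m.*2 <= d)%N ->
  m%:R * (a (d - m) - a m.-1) ^+ 2 <= 4 * \sum_(i < d) a i ^+ 2.
Proof.
move=> m0 md; set M := _ - _.
have M0 : 0 <= M by rewrite subr_ge0 a_le//; lia.
have : \sum_(i < d) a i ^+ 2 + \sum_(i < d) a i ^+ 2 =
       \sum_(0 <= i < d) (a i ^+ 2 + a (d - i.+1)%N ^+ 2).
  rewrite big_split /= -(big_mkord xpredT (fun i => a i ^+ 2)); congr (_ + _).
  by rewrite [LHS]big_nat_rev /= add0n.
have : \sum_(0 <= i < m) (M ^+ 2 / 2) <=
       \sum_(0 <= i < d) (a i ^+ 2 + a (d - i.+1)%N ^+ 2).
  rewrite [leRHS](big_cat_nat _ (n := m))//=; last by lia.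
  rewrite -[leLHS]addr0; apply: lerD; last first.
    by apply: sumr_ge0 => i _; rewrite addr_ge0 ?sqr_ge0.
  rewrite big_nat [leRHS]big_nat; apply: ler_sum => i /andP[_ im].
  (* the pair mirrored across the middle of the sequence *)
  have : M <= a (d - i.+1)%N - a i by apply: lerB; apply: a_le; lia.
  move: (a (d - i.+1)%N) (a i) => x y Mxy.
  have : M ^+ 2 <= (x - y) ^+ 2 by rewrite ler_pXn2r// nnegrE//; lra.
  have := sqr_ge0 (x + y); lra.
rewrite big_const_nat iter_addr_0 subn0 -mulr_natr; lra.
Qed.

(** The d - 2m consecutive gaps that are used add up to at most the spread M of
    the middle part of the sequence, on either side of the points; so their mean
    is at most M / (d - 2m) and convexity gives the bound. *)
Lemma middle_gap_sum_ge m : (0 < m)%N -> (m.*2 < d)%N ->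
  (d - m.*2)%:R ^+ 3 / (a (d - m) - a m.-1) ^+ 2 <=
  \sum_(m <= k < d - m) 2 / ((a k - a k.-1) * (a k.+1 - a k)).
Proof.
move=> m0 md; set M := _ - _; set L : R := _%:R.
have M0 : 0 < M by rewrite subr_gt0 a_lt//; lia.
(* half of the maximizer of 6 L l^2 - 4 M l^3, where the value is still L^3 / M^2 *)
pose l := L / (2 * M).
have l0 : 0 <= l by rewrite divr_ge0// mulr_ge0// ltW.
apply: (@le_trans _ _ (\sum_(m <= k < d - m)
    (6 * l ^+ 2 - 2 * l ^+ 3 * (a k.+1 - a k + (a k - a k.-1))))); last first.
  rewrite big_nat [leRHS]big_nat; apply: ler_sum => k /andP[mk kd].
  rewrite [X in 2 / X]mulrC.
  by apply: amgm_recip => //; rewrite subr_gt0 a_lt//; lia.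
rewrite sumrB big_const_nat iter_addr_0 -mulr_sumr big_split /=.
rewrite (telescope_sumr a); last by lia.
rewrite (eq_bigr (fun k => a k.+1.-1 - a k.-1))// (telescope_sumr (fun k => a k.-1)); last by lia.
have -> : (d - m - m = d - m.*2)%N by lia.
rewrite -[_ *+ (d - m.*2)]mulr_natr -/L.
apply: (@le_trans _ _ (6 * l ^+ 2 * L - 2 * l ^+ 3 * (2 * M))).
  rewrite le_eqVlt; apply/orP; left; apply/eqP.
  by rewrite /l; field; rewrite gt_eqF.
rewrite lerD2l lerN2 ler_wpM2l//; first by rewrite mulr_ge0// exprn_ge0.
have h1 : a m.-1 <= a m by apply: a_le; lia.
have h2 : a (d - m).-1 <= a (d - m)%N by apply: a_le; lia.
rewrite /M; lra.
Qed.

(** Only the middle half of the sequence is used: its spread M satisfies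
    d M^2 = O(sum a_i^2), while the gaps near the two ends may be arbitrarily
    large and give nothing. *)
Lemma gap_sum_ge : (4 <= d)%N ->
  d%:R ^+ 4 / 256 <= (\sum_(i < d) a i ^+ 2) *
    \sum_(1 <= k < d.-1) 2 / ((a k - a k.-1) * (a k.+1 - a k)).
Proof.
move=> d4; pose m := (d %/ 4)%N.
have [m0 m4 m8] : [/\ (0 < m)%N, (4 * m <= d)%N & (d <= 8 * m)%N].
  by rewrite /m; split; lia.
set Q := \sum_(i < d) _; set S := \sum_(1 <= k < d.-1) _.
have spread := @spread_le m m0 ltac:(lia).
have mid := @middle_gap_sum_ge m m0 ltac:(lia).
move: spread mid; set M := _ - _; rewrite -/Q => spread mid.
have M0 : 0 < M by rewrite subr_gt0 a_lt//; lia.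
have midS : \sum_(m <= k < d - m) 2 / ((a k - a k.-1) * (a k.+1 - a k)) <= S.
  rewrite /S [leRHS](big_cat_nat _ (n := m))//=; last by lia.
  rewrite [X in _ + X](big_cat_nat _ (n := (d - m)%N))//=; [|lia|lia].
  rewrite addrCA lerDl addr_ge0//.
    rewrite big_nat sumr_ge0// => k /andP[k1 k2].
    by rewrite divr_ge0// ltW// gap_term_gt0//; lia.
  rewrite big_nat sumr_ge0// => k /andP[k1 k2].
  by rewrite divr_ge0// ltW// gap_term_gt0//; lia.
have Sge : (d - m.*2)%:R ^+ 3 / M ^+ 2 <= S by exact: le_trans midS.
have L2 : d%:R / 2 <= (d - m.*2)%:R :> R.
  rewrite ler_pdivrMr// -natrM ler_nat; lia.
have m8' : d%:R / 8 <= m%:R :> R by rewrite ler_pdivrMr// -natrM ler_nat; lia.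
have d0 : 0 <= d%:R :> R by [].
have S1 : (d%:R / 2) ^+ 3 <= M ^+ 2 * S.
  move: Sge; rewrite ler_pdivrMr ?exprn_gt0// mulrC; apply: le_trans.
  by rewrite ler_pXn2r// nnegrE// divr_ge0.
have S0 : 0 <= S.
  by rewrite -(pmulr_rge0 _ (exprn_gt0 2 M0)) (le_trans _ S1)// exprn_ge0// divr_ge0.
have : d%:R / 8 * (d%:R / 2) ^+ 3 <= m%:R * (M ^+ 2 * S).
  by rewrite ler_pM// ?divr_ge0// exprn_ge0// divr_ge0.
rewrite mulrA => h.
have := ler_wpM2r S0 spread; lra.
Qed.

End GapSum.

(** * Weyl chambers *)

Definition regular d (n : lattice d) := injective (n ord0).

Section Chamber.
Variables (R : realType) (D : nat).
Local Notation L := (lattice D.+1).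
Implicit Types (n : L) (s : 'S_D.+1).

Definition chamber n s :=
  [forall i : 'I_D.+1, forall k : 'I_D.+1,
     (i < k)%N ==> (n ord0 (s i) < n ord0 (s k))].

Lemma chamberP n s :
  reflect (forall i k : 'I_D.+1, (i < k)%N -> n ord0 (s i) < n ord0 (s k))
          (chamber n s).
Proof.
apply: (iffP forallP) => [h i k|h i].
  by have /forallP /(_ k) /implyP := h i.
by apply/forallP => k; apply/implyP; exact: h.
Qed.

Definition rank n (j : 'I_D.+1) := #|[set i | n ord0 i < n ord0 j]%SET|.

Lemma rank_ltn n j : (rank n j < D.+1)%N.
Proof.
rewrite /rank -[X in (_ < X)%N]card_ord -cardsT; apply/proper_card/properP.
by split; [exact: finset.subsetT | exists j; rewrite ?inE// ltxx].
Qed.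

Lemma rank_le n i j : n ord0 i <= n ord0 j -> (rank n i <= rank n j)%N.
Proof.
move=> ij; apply/subset_leq_card/fintype.subsetP => k.
by rewrite !inE => /lt_le_trans; exact.
Qed.

Lemma rank_lt n i j : n ord0 i < n ord0 j -> (rank n i < rank n j)%N.
Proof.
move=> ij; apply/proper_card/properP; split.
  by apply/fintype.subsetP => k; rewrite !inE => /lt_trans; exact.
by exists i; rewrite inE ?ltxx.
Qed.

Lemma chamber_regular n s : chamber n s -> regular n.
Proof.
move=> /chamberP h i j nij.
rewrite -(permKV s i) -(permKV s j); congr (s _); apply/val_inj => /=.
case: (ltngtP (s^-1 i)%g (s^-1 j)%g) => // /h; rewrite !permKV nij ltxx//.
Qed.

(** The position of a coordinate in the increasing order can be read off from n
    alone; this is why chambers are disjoint. *)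
Lemma chamber_rank n s k : chamber n s -> rank n (s k) = k.
Proof.
move=> /chamberP h; rewrite /rank.
have -> : [set i | n ord0 i < n ord0 (s k)]%SET = (s @: [set i : 'I_D.+1 | (i < k)%N])%SET.
  apply/setP => i; apply/idP/imsetP.
    rewrite inE => ik; exists (s^-1 i)%g; last by rewrite permKV.
    rewrite inE ltnNge; apply/negP; rewrite leq_eqVlt => /orP[/eqP/val_inj ki|/h].
      by move: ik; rewrite ki permKV ltxx.
    by rewrite permKV => /(lt_trans ik); rewrite ltxx.
  by case=> j; rewrite !inE => jk ->; exact: h.
rewrite card_imset; last exact: perm_inj.
rewrite cardsE -sum1_card (big_ord_narrow (ltnW (ltn_ord k))) /=.
by rewrite sum1_card card_ord.
Qed.

Lemma chamber_uniq n s t : chamber n s -> chamber n t -> s = t.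
Proof.
move=> hs ht; apply/permP => k; rewrite -(permKV t (s k)); congr (t _).
apply/val_inj; rewrite /= -(chamber_rank (t^-1 (s k))%g ht).
by rewrite permKV (chamber_rank _ hs).
Qed.

Lemma chamber_exists n : regular n -> exists s, chamber n s.
Proof.
move=> rn; pose f j : 'I_D.+1 := inord (rank n j).
have fE j : f j = rank n j :> nat by rewrite inordK// rank_ltn.
have f_inj : injective f.
  move=> i j fij; apply: rn.
  have {}fij : rank n i = rank n j by rewrite -!fE fij.
  by case: (ltgtP (n ord0 i) (n ord0 j)) => // /rank_lt; rewrite fij ltnn.
exists (perm f_inj)^-1%g; apply/chamberP => i k ik.
rewrite ltNge; apply/negP => /rank_le; rewrite -!fE.
by rewrite -![f _](permE f_inj) !permKV leqNgt ik.
Qed.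

(** A unit step cannot make two integers change their order without making them
    equal first: the walls separate the chambers on the lattice. *)
Lemma chamber_step n n' j s : chamber n s -> regular n' ->
  (forall i, i != j -> n' ord0 i = n ord0 i) ->
  `|n' ord0 j - n ord0 j| <= 1 -> chamber n' s.
Proof.
move=> /chamberP h rn' nij nj; apply/chamberP => i k ik.
have := h _ _ ik; have : s i != s k.
  by apply: contraTneq ik => /perm_inj ->; rewrite ltnn.
move=> sik; have : n' ord0 (s i) != n' ord0 (s k).
  by apply: contra_neq sik; exact: rn'.
have [ij|/nij ->] := eqVneq (s i) j; have [kj|/nij ->] := eqVneq (s k) j => //.
- by move: sik; rewrite ij kj eqxx.
- rewrite ij; lia.
- rewrite kj; lia.
Qed.

(** * The concave profile in each coordinate direction *)

Definition order_stat n s (k : nat) : R := (n ord0 (s (inord k)))%:~R.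

Definition gap_product n s k : R :=
  (order_stat n s k - order_stat n s k.-1) *
  (order_stat n s k.+1 - order_stat n s k).

(** The parabola (x - p)(q - x) at x = n_j, with p and q the neighbours of n_j in
    the increasing order. For the least and the greatest coordinate one of the
    two neighbours is missing, and the constant 1 is used: it is superharmonic
    as well when cut off by 0 at the wall. *)
Definition profile (j : 'I_D.+1) n : R :=
  if [pick s | chamber n s] is Some s then
    let k : nat := (s^-1 j)%g in
    if (0 < k < D)%N then gap_product n s k else 1
  else 0.

Lemma profile_chamber n s (k : 'I_D.+1) : chamber n s ->
  profile (s k) n = if (0 < k < D)%N then gap_product n s k else 1.
Proof.
move=> hs; rewrite /profile; case: pickP => [t ht|/(_ s)]; last by rewrite hs.
by rewrite (chamber_uniq ht hs) permK.
Qed.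

Lemma profile_singular n j : ~ regular n -> profile j n = 0.
Proof.
move=> rn; rewrite /profile; case: pickP => // s /chamber_regular.
by move/rn.
Qed.

Lemma order_stat_lt n s i k : chamber n s -> (i < k < D.+1)%N ->
  order_stat n s i < order_stat n s k.
Proof.
move=> /chamberP h ik; rewrite /order_stat ltr_int; apply: h.
by rewrite !inordK//; lia.
Qed.

Lemma gap_product_gt0 n s k : chamber n s -> (0 < k < D)%N ->
  0 < gap_product n s k.
Proof. by move=> hs kD; rewrite mulr_gt0// subr_gt0 order_stat_lt//; lia. Qed.

Lemma profile_gt0 n j : regular n -> 0 < profile j n.
Proof.
move=> /chamber_exists[s hs]; rewrite -(permKV s j) profile_chamber//.
by case: ifP => // kD; exact: gap_product_gt0.
Qed.

Lemma profile_ge0 n j : 0 <= profile j n.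
Proof.
have [rn|/profile_singular ->//] := pselect (regular n).
exact/ltW/profile_gt0.
Qed.

Lemma order_stat_step n s k : chamber n s -> (k < D)%N ->
  order_stat n s k + 1 <= order_stat n s k.+1.
Proof.
move=> /chamberP h ik; rewrite /order_stat -(intrD _ _ 1) ler_int lezD1.
by apply: h; rewrite !inordK//; lia.
Qed.

(** An inequality only, because the step may leave the chamber; the profile is
    then 0, and the parabola is nonnegative there, as gaps of integers are at
    least 1. *)
Lemma profile_neighbour n n' s (k : 'I_D.+1) (e : int) :
  chamber n s -> `|e| = 1 ->
  (forall i, n' ord0 i = n ord0 i + e * (i == s k)%:R) ->
  profile (s k) n' <= if (0 < k < D)%N then
    (order_stat n s k + e%:~R - order_stat n s k.-1) *
    (order_stat n s k.+1 - (order_stat n s k + e%:~R)) else 1.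
Proof.
move=> hs e1 nE; have [rn'|rn'] := pselect (regular n'); last first.
  rewrite profile_singular//; case: ifP => // /andP[k0 kD].
  have e1' : `|e%:~R| = 1 :> R by rewrite -intr_norm e1.
  have := order_stat_step hs kD.
  have := @order_stat_step n s k.-1 hs; rewrite prednK// => /(_ ltac:(lia)).
  move=> h1 h2; have := ler_norm (e%:~R : R); have := ler_norm (- e%:~R : R).
  rewrite normrN e1' => h3 h4; apply: mulr_ge0; lra.
have hs' : chamber n' s.
  apply: (chamber_step (j := s k)) hs rn' _ _ => [i /negPf ik|].
    by rewrite nE ik mulr0 addr0.
  by rewrite nE eqxx mulr1 addrC addKr e1.
rewrite profile_chamber//; case: ifP => // /andP[k0 kD].
have oE i : order_stat n' s i =
    order_stat n s i + e%:~R * (inord i == k)%:R.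
  by rewrite /order_stat nE (inj_eq perm_inj) intrD intrM; case: eqP.
rewrite /gap_product !oE inord_val eqxx mulr1.
have -> : (inord k.-1 == k) = false.
  by apply/eqP => /(congr1 val) /=; rewrite inordK; lia.
have -> : (inord k.+1 == k) = false.
  by apply/eqP => /(congr1 val) /=; rewrite inordK; lia.
by rewrite mulr0 !addr0.
Qed.

(** With gaps x and y, (x - 1)(y + 1) + (x + 1)(y - 1) = 2 x y - 2. *)
Lemma profile_superharmonic n s (k : 'I_D.+1) : chamber n s ->
  (if (0 < k < D)%N then 2 / gap_product n s k else 0) <=
  2 - (profile (s k) (n - delta_mx ord0 (s k)) +
       profile (s k) (n + delta_mx ord0 (s k))) / profile (s k) n.
Proof.
move=> hs; set e : L := delta_mx ord0 (s k).
have hp := @profile_neighbour n (n + e) s k 1 hs (normr1 _).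
have hm := @profile_neighbour n (n - e) s k (-1) hs (normrN1 _).
have nDe i : (n + e) ord0 i = n ord0 i + 1 * (i == s k)%:R.
  by rewrite !mxE eqxx mul1r.
have nBe i : (n - e) ord0 i = n ord0 i + -1 * (i == s k)%:R.
  by rewrite !mxE eqxx mulN1r.
move: (hm nBe) (hp nDe) => {}hm {}hp.
move: hm hp; rewrite (profile_chamber _ hs).
case: ifP => [kD|_] hm hp; last by rewrite divr1; lra.
have gap0 := gap_product_gt0 hs kD.
rewrite -(ler_pM2r gap0) mulrBl !divfK ?gt_eqF//.
move: hm hp; rewrite /gap_product intrN; lra.
Qed.
End Chamber.

(** * Points with distinct coordinates *)

Section Regular.
Variables (R : realType) (d : nat).
Implicit Types (n : lattice d) (u : lattice d -> R[i]).

Lemma lnorm_sq n : lnorm R n ^+ 2 = \sum_(j < d) (n ord0 j)%:~R ^+ 2.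
Proof. by rewrite sqr_sqrtr// sumr_ge0// => j _; exact: sqr_ge0. Qed.

Lemma lnorm_sq_gt0 n : (2 <= d)%N -> regular n -> 0 < lnorm R n ^+ 2.
Proof.
move=> d2 rn; rewrite lt0r sqr_ge0 andbT lnorm_sq.
apply/eqP => /psumr_eq0P n0.
have {}n0 j : n ord0 j = 0.
  apply/eqP; rewrite -(intr_eq0 R) -sqrf_eq0; apply/eqP/n0 => // i _.
  exact: sqr_ge0.
have := rn (Ordinal (ltnW d2)) (Ordinal d2).
by rewrite !n0 => /(_ erefl)/(congr1 val).
Qed.

(** Interchanging two equal coordinates fixes n and changes the sign of u n. *)
Lemma antisymmetric_regular u n : antisymmetric_fun u -> u n != 0 -> regular n.
Proof.
move=> au un i j nij; apply/eqP; apply: contraNT un => ij.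
have /eqP := au _ _ ij n; have -> : xcol i j n = n.
  apply/rowP => k; rewrite mxE; case: perm.tpermP => [->|->|//].
    exact/esym.
  exact: nij.
by rewrite -addr_eq0 -mulr2n mulrn_eq0.
Qed.

Lemma hardy_sum_ge0 u : 0 <= hardy_sum u.
Proof. by apply: fsumr_ge0 => n _; rewrite divr_ge0// sqr_ge0. Qed.

Lemma energy_ge0 u : 0 <= energy u.
Proof.
by apply: fsumr_ge0 => n _; rewrite sumr_ge0// => j _; exact: sqr_ge0.
Qed.

End Regular.

(** * The lower bound *)

Section LowerBound.
Variables (R : realType) (D : nat).

Lemma profile_sum_ge (n : lattice D.+1) : (4 <= D.+1)%N -> regular n ->
  D.+1%:R ^+ 4 / 256 / lnorm R n ^+ 2 <= \sum_(j < D.+1)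
    (2 - (profile R j (n - delta_mx ord0 j) + profile R j (n + delta_mx ord0 j))
       / profile R j n).
Proof.
move=> D4 rn; have [s hs] := chamber_exists rn.
rewrite (reindex_inj (@perm.perm_inj _ s)) /=.
apply: (@le_trans _ _ (\sum_(k < D.+1)
    if (0 < k < D)%N then 2 / gap_product R n s k else 0)); last first.
  by apply: ler_sum => k _; exact: profile_superharmonic.
rewrite ler_pdivrMr; last by apply: lnorm_sq_gt0 => //; lia.
pose a := order_stat R n s.
have a_lt i k : (i < k < D.+1)%N -> a i < a k by exact: order_stat_lt.
have := gap_sum_ge a_lt D4.
have -> : \sum_(i < D.+1) a i ^+ 2 = lnorm R n ^+ 2.
  rewrite lnorm_sq [RHS](reindex_inj (@perm.perm_inj _ s)) /=.
  by apply: eq_bigr => i _; rewrite /a /order_stat inord_val.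
rewrite [leRHS]mulrC; congr (_ <= _ * _).
rewrite -[RHS](big_mkord xpredT
  (fun k => if (0 < k < D)%N then 2 / gap_product R n s k else 0)).
rewrite big_ltn// add0r big_nat_recr/=; last by lia.
rewrite ltnn andbF addr0 [LHS]big_nat [RHS]big_nat.
by apply: eq_bigr => k /andP[-> ->].
Qed.

Lemma hardy_constant_lower : (4 <= D.+1)%N ->
  @hardy_constant R D.+1 (D.+1%:R ^+ 4 / 256).
Proof.
move=> D4 u fu au; rewrite /hardy_sum mulr_fsumr.
under eq_fsbigr do rewrite mulrCA mulrC.
apply: (@energy_ge _ _ _ fu (@profile R D)) => [j n|j n g0|n un].
- exact: profile_ge0.
- apply/eqP; apply/negPn/negP => /(antisymmetric_regular au) rn.
  by have := profile_gt0 R j rn; rewrite g0 ltxx.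
- exact/profile_sum_ge/(antisymmetric_regular au).
Qed.

End LowerBound.

(** * The upper bound *)

Section UpperBound.
Variables (R : realType) (d : nat).

Definition indicator_mx (n : lattice d) : 'M[R[i]]_d :=
  \matrix_(i, k) (n ord0 i == k%:Z)%:R.

(** The indicator matrix is a permutation matrix if n is a permutation of
    (0, ..., d-1), and has a zero row or two equal rows otherwise: so this is the
    sign of the permutation, extended by 0. *)
Definition staircase_fun (n : lattice d) : R[i] := \det (indicator_mx n).

Lemma staircase_antisymmetric : antisymmetric_fun staircase_fun.
Proof.
move=> i j ij n; rewrite /staircase_fun.
have -> : indicator_mx (xcol i j n) = xrow i j (indicator_mx n).
  by apply/matrixP => k l; rewrite !mxE.
by rewrite xrowE det_mulmx det_perm perm.odd_tperm ij expr1 mulN1r.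
Qed.

Lemma staircase_coord n i : staircase_fun n != 0 -> exists k : 'I_d, n ord0 i = k.
Proof.
apply: contra_neqP => /forallNP h; rewrite /staircase_fun (expand_det_row _ i).
apply: big1 => k _; rewrite mxE; have /eqP/negPf -> := h k.
by rewrite mul0r.
Qed.

Lemma staircase_finite : finitely_supported staircase_fun.
Proof.
pose p (f : {ffun 'I_d -> 'I_d}) : lattice d := \row_i (f i)%:Z.
apply: (@sub_finite_set _ _ (p @` setT)); last exact/finite_image/finite_finset.
move=> n /= vn; have /choice[f nf] := fun i => staircase_coord i vn.
by exists (finfun f) => //; apply/rowP => i; rewrite mxE ffunE nf.
Qed.

Lemma staircase_lnorm n : staircase_fun n != 0 ->
  lnorm R n ^+ 2 <= d%:R ^+ 3.
Proof.
move=> vn; rewrite lnorm_sq.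
apply: (@le_trans _ _ (\sum_(j < d) d%:R ^+ 2)).
  apply: ler_sum => j _; have [k ->] := staircase_coord j vn.
  by rewrite ler_pXn2r// ?nnegrE ?ler0z//; rewrite ler_nat ltnW.
by rewrite sumr_const card_ord -[leLHS]mulr_natr -exprSr.
Qed.

Lemma staircase_mass :
  0 < \sum_(n \in [set: lattice d]) cabs (staircase_fun n) ^+ 2.
Proof.
pose p : lattice d := \row_i i%:Z.
have vp : staircase_fun p = 1.
  rewrite /staircase_fun; have -> : indicator_mx p = 1%:M; last exact: det1.
  by apply/matrixP => i k; rewrite !mxE.
have fv := fin_supp_cabs staircase_finite.
rewrite (fsum_fset fv)// (bigD1_seq p) ?fset_uniq//=; last first.
  by rewrite in_fset_set//; apply/mem_set; rewrite /= cabs_sq_eq0 vp oner_neq0.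
rewrite ltr_pwDl//; last by apply: sumr_ge0 => n _; exact: sqr_ge0.
by rewrite lt0r cabs_sq_eq0 vp oner_neq0 sqr_ge0.
Qed.

(** The staircase function has energy at most 4 d times its mass, and Hardy sum
    at least its mass divided by d^3. *)
Lemma hardy_constant_upper (C : R) : (2 <= d)%N -> @hardy_constant R d C ->
  C <= 4 * d%:R ^+ 4.
Proof.
move=> d2 /(_ _ staircase_finite staircase_antisymmetric) hC.
have [C0|C0] := lerP C 0; first by rewrite (le_trans C0)// mulr_ge0// exprn_ge0.
have d3 : 0 < d%:R ^+ 3 :> R by rewrite exprn_gt0// ltr0n ltnW.
have S0 := staircase_mass; set S := \sum_(n \in _) _ in S0.
have SH : S / d%:R ^+ 3 <= hardy_sum staircase_fun.
  rewrite /S mulr_fsuml; apply: ler_fsum.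
  - by apply: fin_supp_sub (fin_supp_cabs staircase_finite) _ => n ->; rewrite mul0r.
  - by apply: fin_supp_sub (fin_supp_cabs staircase_finite) _ => n ->; rewrite mul0r.
  move=> n; have [->|vn] := eqVneq (staircase_fun n) 0.
    by rewrite cabs0 expr0n /= !mul0r.
  rewrite ler_wpM2l ?sqr_ge0// lef_pV2 ?posrE//; first exact: staircase_lnorm.
  apply: lnorm_sq_gt0 => //.
  exact: antisymmetric_regular staircase_antisymmetric vn.
have := energy_le staircase_finite; rewrite -/S => ES.
have : C * (S / d%:R ^+ 3) <= 4 * d%:R * S.
  by rewrite (le_trans _ ES)// (le_trans _ hC)// ler_wpM2l// ltW.
rewrite mulrA ler_pdivrMr// mulrAC ler_pM2r//.
by rewrite -mulrA -exprS.
Qed.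

End UpperBound.

(** * The order of the sharp constant *)

Theorem theorem1p3 (R : realType) :
  (forall d : nat, (2 <= d)%N ->
     is_largest [set C : R | hardy_constant d C] (C_L_as R d)) /\
  (exists (c1 c2 : R) (N : nat), 0 < c1 /\ 0 < c2 /\
     forall d : nat, (2 <= d)%N -> (N <= d)%N ->
       c1 * d%:R ^+ 4 <= C_L_as R d <= c2 * d%:R ^+ 4).
Proof.
have ne d : [set C : R | hardy_constant d C] !=set0.
  by exists 0 => u _ _; rewrite mul0r energy_ge0.
have ub d : (2 <= d)%N ->
    ubound [set C : R | hardy_constant d C] (4 * d%:R ^+ 4).
  by move=> d2 C; exact: hardy_constant_upper.
split=> [d d2|].
  split=> [u fu au|]; last by apply: ub_le_sup; exists (4 * d%:R ^+ 4); exact: ub.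
  (* the supremum is admissible: for each u with nonzero Hardy sum, the quotient
     energy / Hardy sum is an upper bound of all admissible constants *)
  have := hardy_sum_ge0 u; rewrite le0r => /orP[/eqP ->|H0].
    by rewrite mulr0 energy_ge0.
  rewrite -ler_pdivlMr//; apply: ge_sup => // C hC.
  by rewrite ler_pdivlMr//; exact: hC.
exists (1 / 256), 4, 4%N; split; [by rewrite divr_gt0|split=> //].
move=> d d2 d4; apply/andP; split; last exact/ge_sup/ub.
apply: ub_le_sup; first by exists (4 * d%:R ^+ 4); exact: ub.
case: d d2 d4 => // D _ D4 /=; rewrite mulrAC mul1r.
exact: hardy_constant_lower.
Qed.
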